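(* Let $(A,\wedge,\vee,\cdot,\rightarrow,e)$ be an algebra of type $(2,2,2,2,0)$. Then $(A,\wedge,\vee,\cdot,\rightarrow,e)$ is an srl-monoid if and only if $(A,\wedge,\vee,\cdot,e)$ is a commutative l-monoid and the following identities are satisfied: 1) $e\leq (x\wedge y)\rightarrow y$; 2) $x\rightarrow y \leq (z\wedge e)\rightarrow (x\rightarrow y)$; 3) $x\cdot (x\rightarrow y) \leq y$; 4) $z\rightarrow (x\wedge y) = (z\rightarrow x)\wedge (z\rightarrow y)$; 5) $e\rightarrow ((e\rightarrow x)\cdot(e\rightarrow y)) = (e\rightarrow x)\cdot (e\rightarrow y)$; 6) $e\rightarrow y \leq x \rightarrow (x\cdot (e\rightarrow y))$. Here $\leq$ is the lattice order of $(A,\wedge,\vee)$.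
   Context: A commutative l-monoid is an algebra $(A,\wedge,\vee,\cdot,e)$ of type $(2,2,2,0)$ such that $(A,\wedge,\vee)$ is a lattice, $(A,\cdot,e)$ is a commutative monoid and $(a\vee b)\cdot c=(a\cdot c)\vee(b\cdot c)$ for all $a,b,c\in A$. An algebra $(A,\wedge,\vee,\cdot,\rightarrow,e)$ of type $(2,2,2,2,0)$ is an srl-monoid (subresiduated lattice ordered commutative monoid) if $(A,\wedge,\vee,\cdot,e)$ is a commutative l-monoid and there is a subalgebra $Q$ of $(A,\wedge,\vee,\cdot,e)$ such that for all $a,b\in A$ the set $\{q\in Q: a\cdot q\leq b\}$ has a maximum and $a\rightarrow b$ equals this maximum (equivalently: $a\rightarrow b\in Q$ and for all $q\in Q$, $a\cdot q\le b$ iff $q\le a\rightarrow b$). In that case $Q=\{a\in A: e\rightarrow a=a\}$. *)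

(* Defs.v *)
From mathcomp Require Import ssreflect ssrfun.

Set Implicit Arguments.
Unset Strict Implicit.
Unset Printing Implicit Defensive.

Record is_lattice (A : Type) (meet join : A -> A -> A) : Prop := IsLattice {
  lattice_meetC : commutative meet;
  lattice_joinC : commutative join;
  lattice_meetA : associative meet;
  lattice_joinA : associative join;
  lattice_meetK : forall x y, meet x (join x y) = x;
  lattice_joinK : forall x y, join x (meet x y) = x }.

Definition lattice_le (A : Type) (meet : A -> A -> A) (x y : A) : Prop :=
  meet x y = x.

Record is_commutative_monoid (A : Type) (mul : A -> A -> A) (e : A) : Prop :=
  IsCommutativeMonoid {
    monoid_mulA : associative mul;
    monoid_mulC : commutative mul;
    monoid_mul1 : left_id e mul }.

Record is_commutative_lmonoid (A : Type) (meet join mul : A -> A -> A) (e : A)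
    : Prop := IsCommutativeLMonoid {
  lmonoid_lattice : is_lattice meet join;
  lmonoid_monoid : is_commutative_monoid mul e;
  lmonoid_mul_joinl : left_distributive mul join }.

Record is_subalgebra (A : Type) (meet join mul : A -> A -> A) (e : A)
    (Q : A -> Prop) : Prop := IsSubalgebra {
  subalgebra_meet : forall x y, Q x -> Q y -> Q (meet x y);
  subalgebra_join : forall x y, Q x -> Q y -> Q (join x y);
  subalgebra_mul : forall x y, Q x -> Q y -> Q (mul x y);
  subalgebra_unit : Q e }.

Definition is_maximum (A : Type) (le : A -> A -> Prop) (S : A -> Prop) (m : A)
    : Prop :=
  S m /\ forall s, S s -> le s m.

Definition is_srl_monoid (A : Type) (meet join mul imp : A -> A -> A) (e : A)
    : Prop :=
  is_commutative_lmonoid meet join mul e /\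
  exists Q : A -> Prop,
    is_subalgebra meet join mul e Q /\
    forall a b,
      is_maximum (lattice_le meet)
        (fun q => Q q /\ lattice_le meet (mul a q) b) (imp a b).

(* Main.v *)
(* The subalgebra witnessing the srl-monoid structure is forced to be the set of
   fixed points of the interior operator [e -> _]. It contains every [x -> y] by
   2) and 3); the maximality of [a -> b] follows from 6), because a fixed point
   q with a q <= b satisfies q = e -> q <= a -> a (e -> q) = a -> a q <= a -> b. *)

Require Import Defs.
From mathcomp Require Import ssreflect ssrfun.

Set Implicit Arguments.
Unset Strict Implicit.
Unset Printing Implicit Defensive.

Section LatticeOrder.

Variables (A : Type) (meet join : A -> A -> A).
Hypothesis latA : is_lattice meet join.

Local Notation "x <= y" := (lattice_le meet x y).

(** Both absorption laws combine: the second [x] is rewritten as [join x (meet x x)], which [meet x]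
    then absorbs. *)
Lemma lattice_meetxx x : meet x x = x.
Proof. by rewrite -{2}(lattice_joinK latA x x) (lattice_meetK latA). Qed.

Lemma lattice_le_refl x : x <= x.
Proof. exact: lattice_meetxx. Qed.

Lemma lattice_le_trans y x z : x <= y -> y <= z -> x <= z.
Proof.
rewrite /lattice_le => xy yz.
by rewrite -xy -(lattice_meetA latA) yz.
Qed.

Lemma lattice_le_anti x y : x <= y -> y <= x -> x = y.
Proof.
rewrite /lattice_le => xy yx.
by rewrite -xy (lattice_meetC latA).
Qed.

Lemma lattice_leIr x y : meet x y <= y.
Proof. by rewrite /lattice_le -(lattice_meetA latA) lattice_meetxx. Qed.

Lemma lattice_leIl x y : meet x y <= x.
Proof. rewrite (lattice_meetC latA); exact: lattice_leIr. Qed.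

Lemma lattice_lexI x y z : z <= x -> z <= y -> z <= meet x y.
Proof.
by rewrite /lattice_le => zx zy; rewrite (lattice_meetA latA) zx zy.
Qed.

Lemma lattice_leUl x y : x <= join x y.
Proof. exact: lattice_meetK latA x y. Qed.

Lemma lattice_leUr x y : y <= join x y.
Proof. rewrite (lattice_joinC latA); exact: lattice_leUl. Qed.

(** The order is defined by [meet] but [mul] distributes over [join]; this bridge makes
    multiplication monotone. *)
Lemma lattice_le_joinE x y : x <= y <-> join x y = y.
Proof.
split=> [xy | <-]; last exact: lattice_leUl.
by rewrite -xy (lattice_joinC latA) (lattice_meetC latA) (lattice_joinK latA).
Qed.

Lemma lattice_leUx x y z : x <= z -> y <= z -> join x y <= z.
Proof.
move=> /lattice_le_joinE xz /lattice_le_joinE yz; apply/lattice_le_joinE.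
by rewrite -(lattice_joinA latA) yz xz.
Qed.

End LatticeOrder.

Section CommutativeLMonoid.

Variables (A : Type) (meet join mul : A -> A -> A) (e : A).
Hypothesis lmonA : is_commutative_lmonoid meet join mul e.

Local Notation "x <= y" := (lattice_le meet x y).

Let latA := lmonoid_lattice lmonA.
Let monA := lmonoid_monoid lmonA.

Lemma lmonoid_le_mul2r z x y : x <= y -> mul x z <= mul y z.
Proof.
move=> /(lattice_le_joinE latA) xy; apply/(lattice_le_joinE latA).
by rewrite -(lmonoid_mul_joinl lmonA) xy.
Qed.

Lemma lmonoid_le_mul2l z x y : x <= y -> mul z x <= mul z y.
Proof. rewrite !(monoid_mulC monA z); exact: lmonoid_le_mul2r. Qed.

Lemma lmonoid_mulx1 x : mul x e = x.
Proof. by rewrite (monoid_mulC monA) (monoid_mul1 monA). Qed.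

End CommutativeLMonoid.

Theorem theorem2p5 (A : Type) (meet join mul imp : A -> A -> A) (e : A) :
  is_srl_monoid meet join mul imp e <->
  (is_commutative_lmonoid meet join mul e /\
   (forall x y, lattice_le meet e (imp (meet x y) y)) /\
   (forall x y z, lattice_le meet (imp x y) (imp (meet z e) (imp x y))) /\
   (forall x y, lattice_le meet (mul x (imp x y)) y) /\
   (forall x y z, imp z (meet x y) = meet (imp z x) (imp z y)) /\
   (forall x y, imp e (mul (imp e x) (imp e y)) = mul (imp e x) (imp e y)) /\
   (forall x y, lattice_le meet (imp e y) (imp x (mul x (imp e y))))).

Proof.
split=> [[lmonA [Q [subQ impP]]] | [lmonA [ax1 [ax2 [ax3 [ax4 [ax5 ax6]]]]]]];
  have latA := lmonoid_lattice lmonA; have monA := lmonoid_monoid lmonA.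
- have impQ a b : Q (imp a b) by case: (impP a b) => -[].
  have imp_le a b : lattice_le meet (mul a (imp a b)) b.
    by case: (impP a b) => -[].
  have le_imp a b q : Q q -> lattice_le meet (mul a q) b ->
      lattice_le meet q (imp a b).
    by move=> Qq aqb; case: (impP a b) => _; apply.
  (* An element [q] of [Q] is itself the largest member of [Q] below [q], so [Q] consists of fixed
     points of [imp e]. *)
  have impeQ q : Q q -> imp e q = q.
    move=> Qq; apply: (lattice_le_anti latA).
      by rewrite -{1}(monoid_mul1 monA (imp e q)); apply: imp_le.
    apply: le_imp => //; rewrite (monoid_mul1 monA).
    exact: (lattice_le_refl latA).
  have imp_homo z x y : lattice_le meet x y ->
      lattice_le meet (imp z x) (imp z y).
    move=> xy; apply: le_imp => //.
    exact: (lattice_le_trans latA) (imp_le z x) xy.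
  (* Identity 3) is [imp_le] itself; the bullets treat 1), 2), 4), 5) and 6) in this order. *)
  split=> //; split=> [x y|]; last split=> [x y z|]; last split=> //;
    last split=> [x y z|]; last split=> [x y|x y].
  + apply: le_imp; first exact: (subalgebra_unit subQ).
    rewrite (lmonoid_mulx1 lmonA); exact: (lattice_leIr latA).
  (* [imp x y] lies in [Q] and competes for the maximum, because [meet z e] is below the unit. *)
  + apply: le_imp => //; rewrite -{2}(monoid_mul1 monA (imp x y)).
    apply: (lmonoid_le_mul2r lmonA); exact: (lattice_leIr latA).
  + apply: (lattice_le_anti latA).
      apply: (lattice_lexI latA); apply: imp_homo.
        exact: (lattice_leIl latA).
      exact: (lattice_leIr latA).
    (* Closure of [Q] under [meet] makes the meet of the two residuals a candidate for the
       maximum. *)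
    apply: le_imp; first exact: (subalgebra_meet subQ).
    apply: (lattice_lexI latA).
      apply: (lattice_le_trans latA) (imp_le z x).
      apply: (lmonoid_le_mul2l lmonA); exact: (lattice_leIl latA).
    apply: (lattice_le_trans latA) (imp_le z y).
    apply: (lmonoid_le_mul2l lmonA); exact: (lattice_leIr latA).
  + by apply: impeQ; apply: (subalgebra_mul subQ).
  + apply: le_imp => //; exact: (lattice_le_refl latA).
- have imp_homo z x y : lattice_le meet x y ->
      lattice_le meet (imp z x) (imp z y).
    by rewrite /lattice_le -ax4 => ->.
  have impe_le x : lattice_le meet (imp e x) x.
    by rewrite -{1}(monoid_mul1 monA (imp e x)); apply: ax3.
  split=> //; exists (fun a => imp e a = a); split.
    split=> [x y Qx Qy | x y Qx Qy | x y Qx Qy |].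
    + by rewrite ax4 Qx Qy.
    (* Monotonicity of [imp e], which comes from 4), handles joins: each fixed point [x], [y] lies
       below [imp e (join x y)]. *)
    + apply: (lattice_le_anti latA) => //; apply: (lattice_leUx latA).
        rewrite -{1}Qx; apply: imp_homo; exact: (lattice_leUl latA).
      rewrite -{1}Qy; apply: imp_homo; exact: (lattice_leUr latA).
    + by have := ax5 x y; rewrite Qx Qy.
    + apply: (lattice_le_anti latA) => //.
      by have := ax1 e e; rewrite (lattice_meetxx latA).
  move=> a b; split=> [|q [Qq aqb]].
    split=> //; apply: (lattice_le_anti latA) => //.
    (* With [z] taken to be [e], 2) bounds [imp a b] by [imp e (imp a b)]. *)
    by have := ax2 a b e; rewrite (lattice_meetxx latA).
  apply: (lattice_le_trans latA) (imp_homo a _ _ aqb).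
  by have := ax6 a q; rewrite Qq.
Qed.
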